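(* Let $k$ be an integer with $2\le k\le N-1$ such that $\phi^{k-1}-\phi^k>\phi^k-\phi^{k+1}$, and suppose there exists a labeled atom ${\tt Z}\in\aleph_k^\bullet$ such that ${\tt N}^{out}_{\tt Z}(F)\neq\emptyset$ for every $F\in\tilde{\cal F}^{k-1}$. Then $\tilde{\cal F}^{k-1}|_{\uparrow{\tt Z}}=\tilde{\cal T}^\circ_{\tt Z}$ (i.e. $F|_{\uparrow{\tt Z}}\in\tilde{\cal T}^\circ_{\tt Z}$ for all $F\in\tilde{\cal F}^{k-1}$, and every $T\in\tilde{\cal T}^\circ_{\tt Z}$ equals $F|_{\uparrow{\tt Z}}$ for some $F\in\tilde{\cal F}^{k-1}$), and $$\phi^{k-2}-\phi^{k-1}>\phi^{k-1}-\phi^k>\phi^k-\phi^{k+1}.$$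
   Context: $V$ is a directed graph without loops on a finite vertex set ${\tt N}$, $|{\tt N}|=N$; each arc $(i,j)$ has a real weight $v_{ij}$; $V$ is assumed to have at least one spanning tree. An (entering) forest is a directed graph in which at most one arc leaves each vertex and there are no directed cycles; its components are trees, the root of a tree being its unique vertex with no outgoing arc. All forests and trees are subgraphs of $V$. For a subgraph $G$ and ${\tt D}\subseteq{\tt N}$, $\Upsilon^G_{\tt D}=\sum_{i\in{\tt D},(i,j)\in G}v_{ij}$ (heads may lie outside ${\tt D}$), $\Upsilon^G=\Upsilon^G_{\tt N}$. ${\cal F}^j$: spanning forests of $V$ with exactly $j$ trees; $\phi^j=\min_{F\in{\cal F}^j}\Upsilon^F$ ($\phi^j=\infty$ if ${\cal F}^j=\emptyset$; $\phi^0=\infty$); $\tilde{\cal F}^j$: forests in ${\cal F}^j$ of weight $\phi^j$. $\mathfrak{A}_k$: algebra of subsets of ${\tt N}$ generated by the vertex sets of all trees of all forests in $\tilde{\cal F}^k$; $\aleph_k$: its atoms (nonempty elements ${\tt A}$ with ${\tt A}\cap{\tt B}\in\{\emptyset,{\tt A}\}$ for all ${\tt B}\in\mathfrak{A}_k$); $\aleph_k^\bullet$: labeled atoms (containing a root of some tree of some $F\in\tilde{\cal F}^k$). For ${\tt D}\subseteq{\tt N}$: ${\cal T}^\bullet_{\tt D}$ is the set of trees with vertex set ${\tt D}$; ${\cal T}^\circ_{\tt D}$ is the set of trees $T$ with $|{\tt V}T|=|{\tt D}|+1$, ${\tt D}\subset{\tt V}T$, and $T|_{\tt D}\in{\cal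 T}^\bullet_{\tt D}$; $\lambda^\circ_{\tt D}=\min_{T\in{\cal T}^\circ_{\tt D}}\Upsilon^T$ and $\tilde{\cal T}^\circ_{\tt D}=\{T\in{\cal T}^\circ_{\tt D}:\Upsilon^T=\lambda^\circ_{\tt D}\}$. $G|_{\tt D}$ is the induced subgraph on ${\tt D}$. ${\tt N}^{out}_{\tt D}(G)$ is the set of heads $j\notin{\tt D}$ of arcs $(i,j)\in G$ with $i\in{\tt D}$. The outgoing restriction $G|_{\uparrow{\tt D}}$ has as arcs exactly the arcs of $G$ with tail in ${\tt D}$ and vertex set ${\tt D}\cup{\tt N}^{out}_{\tt D}(G)$. For a set ${\cal F}$ of graphs, ${\cal F}|_{\uparrow{\tt D}}=\{F|_{\uparrow{\tt D}}:F\in{\cal F}\}$.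
   Formalization: Trees in T°_D are additionally required to have their root (the extra vertex) outside D; without this, trees whose extra vertex is a leaf with an arc into D would count and the claimed set equality would fail. *)

(* Defs.v *)
From mathcomp Require Import all_boot all_order all_algebra.
From mathcomp Require Import boolp reals constructive_ereal.

Set Implicit Arguments.
Unset Strict Implicit.
Unset Printing Implicit Defensive.

Import Order.TTheory GRing.Theory Num.Theory.

Local Open Scope ring_scope.

(* A graph is a pair (vertex set, arc set), so that graphs with different
   vertex sets can be compared and collected in finite sets. *)
Notation digraph N := ({set N} * {set N * N})%type.

Section Graphs.
Variable N : finType.
Implicit Types (G F T : digraph N) (D Z : {set N}).

Definition vertices G : {set N} := G.1.
Definition arcs G : {set N * N} := G.2.

Definition arc G : rel N := fun x y => (x, y) \in arcs G.

(* Components are taken in the undirected sense. *)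
Definition adjacent G : rel N := fun x y => arc G x y || arc G y x.

Definition component G (x : N) : {set N} :=
  [set y in vertices G | connect (adjacent G) x y].

Definition components G : {set {set N}} :=
  [set component G x | x in vertices G].

Definition acyclic G : bool :=
  `[< forall c : seq N, ucycle (arc G) c -> c = [::] >].

Definition out_degree_le1 G : bool :=
  [forall x, #|[set y | arc G x y]| <= 1]%N.

Definition is_root G (x : N) : bool :=
  (x \in vertices G) && [forall y, ~~ arc G x y].

Definition induced D G : digraph N :=
  (vertices G :&: D, [set a in arcs G | (a.1 \in D) && (a.2 \in D)]).

Definition Nout D G : {set N} :=
  [set j | (j \notin D) && [exists i in D, arc G i j]].

Definition out_restr D G : digraph N :=
  (D :|: Nout D G, [set a in arcs G | a.1 \in D]).

Definition is_algebra (S : {set {set N}}) : bool :=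
  [&& [set: N] \in S,
      [forall A in S, ~: A \in S] &
      [forall A in S, [forall B in S, A :|: B \in S]]].

Definition generated_algebra (S : {set {set N}}) : {set {set N}} :=
  \bigcap_(B : {set {set N}} | is_algebra B && (S \subset B)) B.

Definition atoms_of (S : {set {set N}}) : {set {set N}} :=
  [set A in S | (A != set0) &&
     [forall B in S, (A :&: B == set0) || (A :&: B == A)]].

End Graphs.

Section WeightedDigraph.
Variables (R : realType) (N : finType).
(* E is the arc set of the ambient digraph V; v i j is meaningful only for
   (i, j) \in E. *)
Variables (E : {set N * N}) (v : N -> N -> R).
Implicit Types (G F T : digraph N) (D Z : {set N}) (j k : nat).

Definition subgraph G : bool :=
  (arcs G \subset E) &&
  [forall a in arcs G, (a.1 \in vertices G) && (a.2 \in vertices G)].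

Definition is_forest G : bool :=
  [&& subgraph G, out_degree_le1 G & acyclic G].

Definition is_tree G : bool := is_forest G && (#|components G| == 1)%N.

Definition weight_on D G : R := \sum_(a in arcs G | a.1 \in D) v a.1 a.2.

Definition weight G : R := weight_on [set: N] G.

Definition spanning_forests j : {set digraph N} :=
  [set F | [&& is_forest F, vertices F == [set: N]
             & (#|components F| == j)%N]].

(* The minimum over the empty set is +oo; in particular phi 0 = +oo when N is
   nonempty. *)
Definition phi j : \bar R :=
  \big[Order.min/+oo%E]_(F in spanning_forests j) (weight F)%:E.

Definition min_forests j : {set digraph N} :=
  [set F in spanning_forests j | (weight F)%:E == phi j].

Definition tree_algebra k : {set {set N}} :=
  generated_algebra (\bigcup_(F in min_forests k) components F).

Definition atoms k : {set {set N}} := atoms_of (tree_algebra k).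

Definition labeled_atoms k : {set {set N}} :=
  [set A in atoms k | [exists F in min_forests k, exists x in A, is_root F x]].

Definition trees_on D : {set digraph N} :=
  [set T | is_tree T && (vertices T == D)].

(* Trees obtained from a tree on D by adding one arc from D to a single new
   vertex.  The last clause puts the root, i.e. the new vertex, outside D;
   without it one would also get the trees in which the new vertex is a leaf
   with an arc entering D, and these are never outgoing restrictions to D. *)
Definition outgoing_trees D : {set digraph N} :=
  [set T | [&& is_tree T, (#|vertices T| == #|D|.+1)%N, D \subset vertices T,
               induced D T \in trees_on D
             & [forall x, is_root T x ==> (x \notin D)]]].

Definition lambda_out D : \bar R :=
  \big[Order.min/+oo%E]_(T in outgoing_trees D) (weight T)%:E.

Definition min_outgoing_trees D : {set digraph N} :=
  [set T in outgoing_trees D | (weight T)%:E == lambda_out D].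

End WeightedDigraph.

(* Main.v *)
(* Write swap D F G for the arcs of F whose tail lies in D together with the
   arcs of G whose tail does not.  It is a forest as soon as no arc of G enters D
   from outside; when D is the vertex set of a tree of F, both swap D G F and swap D F G are
   forests, with the same total weight and total number of roots as F and G.
   If D contains no root of G, the swap moves one root from F to G.

   The gap at k therefore forces any two minimal k-forests to have exactly one
   root of one in each tree of the other, and minimal k-forests are stable
   under swapping trees.  It follows that a labeled atom Z contains one root of
   each minimal k-forest, and, by shrinking trees, that Z is itself a tree of
   some minimal k-forest F0.

   Let G be a (k-1)- or (k-2)-forest of minimal weight.  If a tree D <> Z of F0
   has no root of G, then swap D G F0 is a (k-1)-forest without arcs leaving Z,
   so by hypothesis it is not minimal.  For k-1 this excludes such a D, so G has
   one root in each tree of F0 other than Z and none in Z, and swap Z G F0 is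
   minimal as well.  For k-2 such a D always exists, and the swap would be
   minimal without the strict gap at k-1. *)
Require Import Defs.
From mathcomp Require Import all_boot all_order all_algebra.
From mathcomp Require Import boolp reals constructive_ereal.
From mathcomp Require Import zify lra.
(* Restores [Defs.arc], shadowed by [path.arc]. *)
Import Defs.

Set Implicit Arguments.
Unset Strict Implicit.
Unset Printing Implicit Defensive.

Import Order.TTheory GRing.Theory Num.Theory.

Local Open Scope ring_scope.

(** * Roots and components of acyclic digraphs with out-degree at most one *)

Section Digraphs.
Variable N : finType.
Implicit Types (F G T : digraph N) (D Z : {set N}).

Definition sinks G : {set N} := [set x | [forall y, ~~ arc G x y]].

Lemma sinkP G x : reflect (forall y, ~~ arc G x y) (x \in sinks G).
Proof. by rewrite inE; apply: forallP. Qed.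

Lemma not_sink G x : x \notin sinks G -> exists y, arc G x y.
Proof. by rewrite inE negb_forall => /existsP[y]; rewrite negbK; exists y. Qed.

Lemma out_degree_le1P G :
  reflect (forall x y z, arc G x y -> arc G x z -> y = z) (out_degree_le1 G).
Proof.
apply: (iffP forallP) => [dG x y z xy xz | dG x].
  by apply: (card_le1_eqP (dG x)); rewrite inE.
by apply/card_le1_eqP => y z; rewrite !inE => xy xz; apply: dG xz xy.
Qed.

(** If [G] is acyclic, the number of vertices reachable from [x] drops along arcs and serves as rank
    [h]; conversely a rank would strictly decrease around a cycle. *)
Lemma acyclicP G :
  reflect (exists h : N -> nat, forall x y, arc G x y -> (h y < h x)%N)
          (acyclic G).
Proof.
apply: (iffP (asboolP _)) => [acG | [h hG] [//|x p] /andP[cp _]].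
  exists (fun x => #|connect (arc G) x|) => x y xy.
  apply/proper_card/properP; split.
    by apply/subsetP => z; apply/connect_trans/connect1.
  exists x; first exact: connect0.
  apply/negP => /connectP[q pq]; case/shortenP: pq => p pp up _ eqx.
  suff: y :: p = [::] by [].
  by apply: acG; rewrite /ucycle /= rcons_path pp -eqx xy.
have dec q y : path (arc G) y q -> (h (last y q) + size q <= h y)%N.
  elim: q y => [|z q IHq] y /=; first by rewrite addn0.
  case/andP=> /hG yz /IHq le; rewrite addnS.
  exact: leq_ltn_trans le yz.
by have := dec _ _ cp; rewrite last_rcons size_rcons addnS ltnNge leq_addr.
Qed.

(** In an acyclic digraph some sink is always reachable, so the default [x] never matters there;
    out-degree at most one makes this sink unique. *)
Definition root_of G x : N :=
  odflt x [pick r in sinks G | connect (arc G) x r].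

Lemma root_ind G : acyclic G -> forall P : N -> Prop,
  (forall r, r \in sinks G -> P r) ->
  (forall x y, arc G x y -> P y -> P x) -> forall x, P x.
Proof.
case/acyclicP => h hG P Psink Parc x.
have [n] := ubnP (h x); elim: n x => // n IHn x lex.
have [/Psink //|/not_sink[y xy]] := boolP (x \in sinks G).
exact: Parc xy (IHn _ (leq_trans (hG _ _ xy) lex)).
Qed.

Section Functional.
Variable G : digraph N.
Hypotheses (acG : acyclic G) (dG : out_degree_le1 G).

Lemma root_ofP x : root_of G x \in sinks G /\ connect (arc G) x (root_of G x).
Proof.
rewrite /root_of; case: pickP => [r /andP[] //|no].
suff [r rr xr]: exists2 r, r \in sinks G & connect (arc G) x r.
  by have := no r; rewrite rr xr.
elim/(root_ind acG): x {no} => [r rr|x y xy [r rr yr]]; exists r => //.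
exact: connect_trans (connect1 xy) yr.
Qed.

Lemma connect_sink x r : r \in sinks G -> connect (arc G) r x -> x = r.
Proof.
by move=> /sinkP rr /connectP[[|y p] //= /andP[ry _]]; rewrite (negPf (rr y)) in ry.
Qed.

Lemma root_of_sink r : r \in sinks G -> root_of G r = r.
Proof. by move=> rr; apply: connect_sink (root_ofP r).2. Qed.

Lemma root_of_unique x r : r \in sinks G -> connect (arc G) x r -> root_of G x = r.
Proof.
suff uniq s : r \in sinks G -> connect (arc G) x r ->
    s \in sinks G -> connect (arc G) x s -> s = r.
  by move=> rr xr; have [sx cx] := root_ofP x; apply: uniq.
elim/(root_ind acG): x => [t ts|x y xy IHy] rr xr ss xs.
  by rewrite (connect_sink ts xr) (connect_sink ts xs).
have yconn t : t \in sinks G -> connect (arc G) x t -> connect (arc G) y t.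
  move=> /sinkP ts /connectP[[|z p] /= pp def_t].
    by have := ts y; rewrite def_t xy.
  case/andP: pp => xz pp; rewrite ((out_degree_le1P _ dG) _ _ _ xy xz).
  by apply/connectP; exists p.
exact: IHy (yconn _ rr xr) ss (yconn _ ss xs).
Qed.

Lemma root_of_arc x y : arc G x y -> root_of G x = root_of G y.
Proof.
move=> xy; have [sy cy] := root_ofP y.
exact: root_of_unique sy (connect_trans (connect1 xy) cy).
Qed.

Lemma adjacent_sym : connect_sym (adjacent G).
Proof. by apply: sym_connect_sym => x y; rewrite /adjacent orbC. Qed.

Lemma connect_adjacent x y : connect (arc G) x y -> connect (adjacent G) x y.
Proof.
by apply: connect_sub => a b ab; apply: connect1; rewrite /adjacent ab.
Qed.

(** [root_of] is constant along arcs in either direction, so the undirected components are its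
    fibres. This is what lets trees be counted by sinks. *)
Lemma connect_adjacentE x y :
  connect (adjacent G) x y = (root_of G x == root_of G y).
Proof.
apply/idP/eqP => [/connectP[p pp ->]|exy].
  elim: p x pp => //= z p IHp x /andP[xz /IHp <-].
  by case/orP: xz => /root_of_arc.
have [_ cx] := root_ofP x; have [_ cy] := root_ofP y.
apply: connect_trans (connect_adjacent cx) _.
by rewrite exy adjacent_sym connect_adjacent.
Qed.

Lemma component_root x : vertices G = setT ->
  component G x = [set y | root_of G y == root_of G x].
Proof.
by move=> vG; apply/setP => y; rewrite !inE vG inE connect_adjacentE eq_sym.
Qed.

Lemma card_components : vertices G = setT -> #|components G| = #|sinks G|.
Proof.
move=> vG; have -> : components G = [set component G r | r in sinks G].
  apply/setP => C; apply/imsetP/imsetP => [] [x _ ->].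
    exists (root_of G x); first exact: (root_ofP x).1.
    by rewrite !component_root // (root_of_sink (root_ofP x).1).
  by exists x; rewrite ?vG ?inE.
rewrite card_in_imset // => r s rr ss /setP/(_ r).
by rewrite !component_root // !inE eqxx !root_of_sink // => /esym/eqP.
Qed.

End Functional.

(** * Exchanging the arcs that start in a vertex set *)

Section Swap.
Variables (D : {set N}) (F G : digraph N).

(** The vertex set is [setT] so that the result spans even when [F] or [G] does not, as with an
    outgoing tree or the empty graph. *)
Definition swap : digraph N :=
  (setT, [set a | a \in arcs (if a.1 \in D then F else G)]).

Lemma in_arcs_swap a :
  (a \in arcs swap) = if a.1 \in D then a \in arcs F else a \in arcs G.
Proof. by rewrite inE; case: ifP. Qed.

Lemma arc_swap x y : arc swap x y = if x \in D then arc F x y else arc G x y.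
Proof. exact: in_arcs_swap. Qed.

Lemma sinks_swap : sinks swap = (sinks F :&: D) :|: (sinks G :\: D).
Proof.
apply/setP => x; rewrite !inE; under eq_forallb => y do rewrite arc_swap.
by case: (x \in D); rewrite ?andbT ?andbF ?orbF.
Qed.

Lemma card_sinks_swap : #|sinks swap| = (#|sinks F :&: D| + #|sinks G :\: D|)%N.
Proof.
rewrite sinks_swap cardsU [X in (_ - X)%N](_ : _ = 0)%N ?subn0 //.
by apply/eqP; rewrite cards_eq0; apply/eqP/setP => x; rewrite !inE; case: (x \in D); rewrite ?andbF.
Qed.

(** Lifting the rank of [F] on [D] above every rank of [G] makes arcs from [D] to its complement
    decrease too; arcs in the other direction are excluded. *)
Lemma acyclic_swap : acyclic F -> acyclic G ->
  (forall x y, arc G x y -> x \notin D -> y \notin D) -> acyclic swap.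
Proof.
move=> /acyclicP[f fF] /acyclicP[g gG] nD; apply/acyclicP.
exists (fun x => if x \in D then f x + \max_y (g y).+1 else g x)%N => x y.
rewrite arc_swap; case: ifP => [xD xy|/negbT xD xy]; last first.
  by rewrite (negPf (nD _ _ xy xD)) gG.
case: ifP => _; first by rewrite ltn_add2r fF.
by apply: leq_trans (leq_addl _ _); apply: (leq_bigmax y).
Qed.

Lemma out_degree_swap : out_degree_le1 F -> out_degree_le1 G -> out_degree_le1 swap.
Proof.
move=> /out_degree_le1P dF /out_degree_le1P dG; apply/out_degree_le1P => x y z.
by rewrite !arc_swap; case: ifP => _; [apply: dF | apply: dG].
Qed.

End Swap.

Lemma swapC D F G : swap D F G = swap (~: D) G F.
Proof. by congr (_, _); apply/setP => a; rewrite !inE; case: (_ \in D). Qed.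

Section Forest.
Variable E : {set N * N}.

Lemma arcs_swap_sub D F G : arcs F \subset E -> arcs G \subset E ->
  arcs (swap D F G) \subset E.
Proof.
move=> /subsetP FE /subsetP GE; apply/subsetP => a; rewrite inE.
by case: ifP => _; [apply: FE | apply: GE].
Qed.

Lemma forest_swap D F G : is_forest E F -> is_forest E G ->
  (forall x y, arc G x y -> x \notin D -> y \notin D) ->
  is_forest E (swap D F G).
Proof.
move=> /and3P[/andP[FE _] dF aF] /and3P[/andP[GE _] dG aG] nD.
apply/and3P; split; last 2 first.
- exact: out_degree_swap.
- exact: acyclic_swap.
rewrite /subgraph arcs_swap_sub //=.
by apply/forallP => a; rewrite !inE implybT.
Qed.

Lemma spanning_forestsP j F :
  reflect [/\ is_forest E F, vertices F = setT & #|sinks F| = j]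
          (F \in spanning_forests E j).
Proof.
rewrite inE; apply: (iffP and3P) => [] [fF].
  move=> /eqP vF /eqP <-; split=> //.
  by have /and3P[_ dF aF] := fF; rewrite card_components.
move=> vF <-; split=> //; rewrite ?vF //.
by have /and3P[_ dF aF] := fF; rewrite card_components.
Qed.

End Forest.
End Digraphs.

(** Shared by minimal forests and minimal outgoing trees: it trades an extended-real minimum for
    comparisons of real weights. *)
Lemma bigmin_attainedP (R : realType) (I : finType) (S : {set I})
    (w : I -> R) x :
  reflect (x \in S /\ forall y, y \in S -> w x <= w y)
    (x \in [set y in S | (w y)%:E == \big[Order.min/+oo%E]_(z in S) (w z)%:E]).
Proof.
rewrite inE; apply: (iffP andP) => [] [xS].
  by move/eqP=> eqx; split=> // y yS; rewrite -lee_fin eqx bigmin_le_cond.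
move=> minx; split=> //; rewrite eq_le bigmin_le_cond // andbT.
by apply/bigmin_geP; split=> [|y yS]; rewrite ?leey ?lee_fin ?minx.
Qed.

(** * Trees of a spanning forest and swaps along them *)

Section Trees.
Variables (N : finType) (E : {set N * N}).
Implicit Types (F G T : digraph N) (D Z : {set N}).

Definition tree F r : {set N} := [set x | root_of F x == r].

Lemma in_tree F r x : (x \in tree F r) = (root_of F x == r).
Proof. exact: in_set. Qed.

Lemma forest_acyclic F : is_forest E F -> acyclic F.
Proof. by case/and3P. Qed.

Lemma forest_out_degree F : is_forest E F -> out_degree_le1 F.
Proof. by case/and3P. Qed.

Lemma tree_arc F r x y : is_forest E F -> arc F x y ->
  (x \in tree F r) = (y \in tree F r).
Proof. by case/and3P => _ dF aF /(root_of_arc aF dF) exy; rewrite !inE exy. Qed.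

Lemma sinks_tree F r : acyclic F -> r \in sinks F ->
  sinks F :&: tree F r = [set r].
Proof.
move=> aF rF; apply/setP => x; rewrite in_setI in_set1 in_tree.
apply/andP/eqP => [[xF /eqP <-]|->]; first by rewrite root_of_sink.
by rewrite root_of_sink // eqxx.
Qed.

Lemma spanning_swap D F G i j :
  F \in spanning_forests E i -> G \in spanning_forests E j ->
  (forall x y, arc G x y -> x \notin D -> y \notin D) ->
  swap D F G
    \in spanning_forests E (#|sinks F :&: D| + #|sinks G :\: D|).
Proof.
move=> /spanning_forestsP[fF _ _] /spanning_forestsP[fG _ _] nD.
apply/spanning_forestsP; split=> //; first exact: forest_swap.
exact: card_sinks_swap.
Qed.

(** Arcs of [F] neither enter nor leave a tree of [F], so swapping over the tree or over its
    complement is allowed. The tree holds one root of [F] and [g] roots of [G], whence the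
    counts. *)
Lemma swap_tree F G r i j : r \in sinks F ->
    F \in spanning_forests E i -> G \in spanning_forests E j ->
    let g := #|sinks G :&: tree F r| in
  swap (tree F r) G F \in spanning_forests E (g + i.-1) /\
  swap (tree F r) F G \in spanning_forests E (1 + (j - g)).
Proof.
move=> rF Fi Gj g.
have [fF _ cF] := spanning_forestsP _ _ _ Fi.
have [fG _ cG] := spanning_forestsP _ _ _ Gj.
have sF := sinks_tree (forest_acyclic fF) rF.
have -> : i.-1 = #|sinks F :\: tree F r|.
  by rewrite cardsD sF cards1 cF subn1.
have -> : (1 + (j - g) = #|sinks F :&: tree F r| + #|sinks G :\: tree F r|)%N.
  by rewrite sF cards1 cardsD cG.
split; first by apply: spanning_swap Gj Fi _ => x y /(tree_arc r fF) ->.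
have -> : (#|sinks F :&: tree F r| + #|sinks G :\: tree F r| =
    #|sinks G :&: ~: tree F r| + #|sinks F :\: ~: tree F r|)%N.
  by rewrite addnC !setDE setCK.
rewrite swapC; apply: spanning_swap Gj Fi _ => x y /(tree_arc r fF).
by rewrite !in_setC => ->.
Qed.

(** From a spanning tree, arcs are deleted one at a time: swapping in the empty graph at a non-sink
    [x] adds exactly the root [x]. *)
Lemma spanning_forests_exist j : spanning_forests E 1 != set0 ->
  (0 < j <= #|N|)%N -> exists F, F \in spanning_forests E j.
Proof.
move=> /set0Pn[F0 F01] /andP[]; case: j => // j _.
elim: j => [|j IHj] ltj; first by exists F0.
have [F Fj] := IHj (ltnW ltj).
have [fF _ cF] := spanning_forestsP _ _ _ Fj.
have /subsetPn[x _ xF] : ~~ ([set: N] \subset sinks F).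
  by apply/negP => /subset_leq_card; rewrite cardsT cF leqNgt ltj.
have e0 : is_forest E (set0, set0).
  apply/and3P; split.
  - by rewrite /subgraph sub0set; apply/forallP => a; rewrite inE.
  - by apply/out_degree_le1P => a b c; rewrite /arc inE.
  - by apply/acyclicP; exists (fun=> 0%N) => a b; rewrite /arc inE.
exists (swap [set x] (set0, set0) F); apply/spanning_forestsP; split=> //.
  rewrite swapC; apply: forest_swap => // a b; by rewrite /arc inE.
have -> : sinks (swap [set x] (set0, set0) F) = x |: sinks F.
  rewrite sinks_swap; apply/setP => y; rewrite !inE.
  have -> : [forall z, ~~ arc (set0, set0) y z] by apply/forallP => z; rewrite /arc inE.
  by rewrite /=; case: eqP.
by rewrite cardsU1 xF cF.
Qed.

End Trees.

(** * Minimal forests and the consequences of a strict gap at [k] *)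

Section Weights.
Variables (R : realType) (N : finType) (E : {set N * N}) (v : N -> N -> R).
Implicit Types (F G T : digraph N) (D Z : {set N}).

Local Notation weight := (weight v).
Local Notation M := (min_forests E v).
Local Notation SF := (spanning_forests E).

Lemma weightE F :
  weight F = \sum_a (if a \in arcs F then v a.1 a.2 else 0).
Proof.
rewrite /Defs.weight /weight_on -big_mkcond /=.
by apply: eq_bigl => a; rewrite inE andbT.
Qed.

Lemma weight_swapD D F G :
  weight (swap D F G) + weight (swap D G F) = weight F + weight G.
Proof.
rewrite !weightE -!big_split; apply: eq_bigr => a _ /=.
by rewrite !inE; case: (a.1 \in D) => //; rewrite addrC.
Qed.

Lemma min_forestsP j F :
  reflect (F \in SF j /\ forall G, G \in SF j -> weight F <= weight G) (F \in M j).
Proof. exact: bigmin_attainedP. Qed.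

Lemma min_forests_spanning j F : F \in M j -> F \in SF j.
Proof. by case/min_forestsP. Qed.

Lemma phiE j F : F \in M j -> phi E v j = (weight F)%:E.
Proof. by rewrite inE => /andP[_ /eqP ->]. Qed.

Lemma min_forests_exist j F : F \in SF j -> exists G, G \in M j.
Proof.
move=> Fj; case: (arg_minP weight Fj) => G Gj minG.
by exists G; apply/min_forestsP.
Qed.

(** [K] weighs at least as much as [G], so the bound on the sum leaves [H] no heavier than [F]. *)
Lemma min_forests_sum i j F G H K :
  F \in M i -> G \in M j -> H \in SF i -> K \in SF j ->
  weight H + weight K <= weight F + weight G -> H \in M i.
Proof.
move=> /min_forestsP[_ minF] /min_forestsP[_ minG] Hi Kj le.
apply/min_forestsP; split=> // L /minF leL; have := minG _ Kj; lra.
Qed.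

Section Gap.
Variable k : nat.
Hypothesis k_gt0 : (0 < k)%N.
Hypothesis gap : forall F G H, F \in M k -> G \in SF k.-1 -> H \in SF k.+1 ->
  weight F + weight F < weight G + weight H.

(** Without a root of [G] in the tree, the two swaps would have [k - 1] and [k + 1] trees and total
    weight twice the minimum for [k], against [gap]. *)
Lemma sinks_tree_neq0 F G r : F \in M k -> G \in M k -> r \in sinks F ->
  exists2 s, s \in sinks G & root_of F s = r.
Proof.
move=> FM GM rF.
have [g0|/set0Pn[s]] := eqVneq (sinks G :&: tree F r) set0; last first.
  by rewrite in_setI in_tree => /andP[sG /eqP]; exists s.
have /= := swap_tree rF (min_forests_spanning FM) (min_forests_spanning GM).
rewrite g0 cards0 add0n subn0 => -[H1 H2]; have := gap FM H1 H2.
rewrite weight_swapD.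
have [_ minG] := min_forestsP _ _ GM.
by have := minG _ (min_forests_spanning FM); lra.
Qed.

(** [root_of F] maps the [k] roots of [G] onto the [k] roots of [F], hence injectively. *)
Lemma root_of_inj F G : F \in M k -> G \in M k ->
  {in sinks G &, injective (root_of F)}.
Proof.
move=> FM GM; apply/imset_injP.
have [fF _ cF] := spanning_forestsP _ _ _ (min_forests_spanning FM).
have [_ _ cG] := spanning_forestsP _ _ _ (min_forests_spanning GM).
suff -> : root_of F @: sinks G = sinks F by rewrite cF cG.
apply/setP => r; apply/imsetP/idP.
  by case=> s _ ->; case: (root_ofP (forest_acyclic fF) s).
by move/(sinks_tree_neq0 FM GM)=> [s sG <-]; exists s.
Qed.

Lemma sinks_treeE F G s : F \in M k -> G \in M k -> s \in sinks G ->
  sinks G :&: tree F (root_of F s) = [set s].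
Proof.
move=> FM GM sG; apply/setP => t; rewrite in_setI in_set1 in_tree.
apply/andP/eqP => [[tG /eqP]|->]; last by rewrite eqxx.
by move/(root_of_inj FM GM tG sG).
Qed.

Lemma swap_tree_min F G r : F \in M k -> G \in M k -> r \in sinks F ->
  swap (tree F r) G F \in M k /\ swap (tree F r) F G \in M k.
Proof.
move=> FM GM rF; have [s sG eqr] := sinks_tree_neq0 FM GM rF; subst r.
have /= := swap_tree rF (min_forests_spanning FM) (min_forests_spanning GM).
rewrite sinks_treeE // cards1 !add1n subn1 prednK // => -[HF HG].
by split; [apply: min_forests_sum GM FM HF HG _ | apply: min_forests_sum FM GM HG HF _];
  rewrite weight_swapD.
Qed.

(** Let [t] be the root of [G] in the tree of [r] in [F]. Then [t] and [r] share a tree in every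
    minimal forest; applied to [G], this gives [root_of G r = t]. *)
Lemma root_of_root_of F G H r : F \in M k -> G \in M k -> H \in M k ->
  r \in sinks F -> root_of H (root_of G r) = root_of H r.
Proof.
move=> FM GM HM rF; have [t tG eqr] := sinks_tree_neq0 FM GM rF.
have [fG _ _] := spanning_forestsP _ _ _ (min_forests_spanning GM).
suff eqt K : K \in M k -> root_of K t = root_of K r.
  by rewrite -(eqt G) // (root_of_sink (forest_acyclic fG)) // eqt.
move=> KM; have [LM _] := swap_tree_min FM GM rF.
have [fK _ _] := spanning_forestsP _ _ _ (min_forests_spanning KM).
have [rK _] := root_ofP (forest_acyclic fK) r.
(* The swapped forest has the roots of [F] with [t] in place of [r]. The one in the tree of [r] in
   [K] must be [t], as [r] is the only root of [F] there. *)
have [u + equ] := sinks_tree_neq0 KM LM rK.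
rewrite sinks_swap -{1}eqr sinks_treeE // in_setU in_set1 in_setD.
case/orP => [/eqP <- //|/andP[nu uF]].
have equr := root_of_inj KM FM uF rF equ.
have [fF _ _] := spanning_forestsP _ _ _ (min_forests_spanning FM).
by rewrite equr in_tree (root_of_sink (forest_acyclic fF)) ?eqxx in nu.
Qed.

End Gap.
End Weights.

(** * Atoms of the tree algebra, and labeled atoms as trees *)

Lemma sub_generated_algebra (N : finType) (S : {set {set N}}) :
  S \subset generated_algebra S.
Proof. by apply/bigcapsP => B /andP[]. Qed.

Lemma generated_algebra_sub (N : finType) (S B : {set {set N}}) :
  is_algebra B -> S \subset B -> generated_algebra S \subset B.
Proof. by move=> aB SB; apply: bigcap_inf; rewrite aB. Qed.

Section Atoms.
Variables (R : realType) (N : finType) (E : {set N * N}) (v : N -> N -> R).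
Implicit Types (F G T : digraph N) (D Z : {set N}).

Local Notation weight := (weight v).
Local Notation M := (min_forests E v).
Local Notation SF := (spanning_forests E).

Variable k : nat.

Lemma atom_root_of Z F x y : Z \in atoms E v k -> F \in M k ->
  x \in Z -> y \in Z -> root_of F x = root_of F y.
Proof.
rewrite inE => /and3P[_ _ /forall_inP atomZ] FM xZ yZ.
have [/and3P[_ dF aF] vF _] := spanning_forestsP _ _ _ (min_forests_spanning FM).
have: component F x \in tree_algebra E v k.
  apply/(subsetP (sub_generated_algebra _))/bigcupP; exists F => //.
  by apply: imset_f; rewrite vF.
move/atomZ; rewrite component_root // => /orP[/eqP/setP/(_ x)|/eqP/setP/(_ y)].
  by rewrite !inE xZ eqxx.
by rewrite !inE yZ => /eqP.
Qed.

(** The sets that do not separate [x] from [y] form an algebra containing all trees of minimal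
    forests, hence the whole tree algebra. *)
Lemma atom_saturated Z x y : Z \in atoms E v k ->
  (forall F, F \in M k -> root_of F x = root_of F y) -> x \in Z -> y \in Z.
Proof.
rewrite inE => /andP[+ _] xy xZ.
pose B := [set A : {set N} | (x \in A) == (y \in A)].
suff /subsetP sB : tree_algebra E v k \subset B.
  by move/sB; rewrite inE xZ => /eqP.
apply: generated_algebra_sub.
  apply/and3P; split; first by rewrite !inE.
    by apply/forall_inP => A; rewrite !inE => /eqP ->.
  apply/forall_inP => A; rewrite inE => /eqP eA.
  by apply/forall_inP => C; rewrite !inE eA => /eqP ->.
apply/bigcupsP => F FM; apply/subsetP => C /imsetP[z _ ->].
have [/and3P[_ dF aF] vF _] := spanning_forestsP _ _ _ (min_forests_spanning FM).
by rewrite component_root // !inE xy.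
Qed.

Hypothesis k_gt0 : (0 < k)%N.
Hypothesis gap : forall F G H, F \in M k -> G \in SF k.-1 -> H \in SF k.+1 ->
  weight F + weight F < weight G + weight H.
Variable Z : {set N}.
Hypothesis Z_labeled : Z \in labeled_atoms E v k.

Lemma labeled_atom_atom : Z \in atoms E v k.
Proof. by move: Z_labeled; rewrite inE => /andP[]. Qed.

(** If [r] in [Z] is a root of [G], then [root_of F x = root_of F r], and no minimal forest
    separates this vertex from [r]. *)
Lemma labeled_atom_root F x : F \in M k -> x \in Z -> root_of F x \in Z.
Proof.
move=> FM xZ; have atomZ := labeled_atom_atom.
move: Z_labeled; rewrite inE => /andP[_ /exists_inP[G GM /exists_inP[r rZ]]].
case/andP => _ rG; rewrite (atom_root_of atomZ FM xZ rZ).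
apply: (atom_saturated atomZ _ rZ) => H HM.
by rewrite (root_of_root_of k_gt0 gap GM FM HM) // inE.
Qed.

(* For F minimising the size of D F, the tree of F rooted in Z, swapping a tree
   of any other G with F gives D F \subset D G; so vertices of D F share the
   tree of Z in every minimal forest. *)
Lemma tree_of_labeled_atom :
  exists2 F, F \in M k & forall x, (root_of F x \in Z) = (x \in Z).
Proof.
have atomZ := labeled_atom_atom.
have [F1 FM1] : exists F, F \in M k.
  by move: Z_labeled; rewrite inE => /andP[_ /exists_inP[F FM _]]; exists F.
pose D F := [set x | root_of F x \in Z].
have [F FM minF] := arg_minP (fun F => #|D F|) FM1.
exists F => // x; apply/idP/idP; last exact: labeled_atom_root.
have [z zZ] : exists z, z \in Z.
  by apply/set0Pn; move: atomZ; rewrite inE => /and3P[].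
have [fF _ _] := spanning_forestsP _ _ _ (min_forests_spanning FM).
have DF G : G \in M k -> D F \subset D G.
  move=> GM.
  have [fG _ _] := spanning_forestsP _ _ _ (min_forests_spanning GM).
  have [rG _] := root_ofP (forest_acyclic fG) z.
  have rGZ := labeled_atom_root GM zZ.
  have DG y : (y \in tree G (root_of G z)) = (root_of G y \in Z).
    rewrite in_tree; apply/eqP/idP => [-> //|yZ].
    have [yG _] := root_ofP (forest_acyclic fG) y.
    by rewrite -(atom_root_of atomZ GM yZ zZ) (root_of_sink (forest_acyclic fG) yG).
  have [HM _] := swap_tree_min k_gt0 gap GM FM rG.
  set H := swap _ _ _ in HM.
  have [fH _ _] := spanning_forestsP _ _ _ (min_forests_spanning HM).
  (* [H] follows [F] inside [D G] and [G] outside it, so none of its arcs enters [D G] from outside;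
     membership in both sets passes backwards along the arcs of [H]. *)
  suff sub y : root_of H y \in Z -> (root_of F y \in Z) && (root_of G y \in Z).
    have sH : D H \subset D F :&: D G.
      by apply/subsetP => y; rewrite !inE; apply: sub.
    have /eqP <- : D F :&: D G == D F.
      rewrite eqEcard subsetIl; apply: leq_trans (minF _ HM) _.
      exact: subset_leq_card.
    exact: subsetIr.
  elim/(root_ind (forest_acyclic fH)): y => [s sH|a b ab IHb].
    by rewrite (root_of_sink (forest_acyclic fH)) // => sZ; rewrite !labeled_atom_root.
  rewrite (root_of_arc (forest_acyclic fH) (forest_out_degree fH) ab) => /IHb.
  case/andP=> bF bG; move: ab; rewrite arc_swap DG.
  have [aG ab|/negP naG ab] := boolP (root_of G a \in Z).
    by rewrite (root_of_arc (forest_acyclic fF) (forest_out_degree fF) ab) bF.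
  by case: naG; rewrite (root_of_arc (forest_acyclic fG) (forest_out_degree fG) ab).
move=> xDF; apply: (atom_saturated atomZ _ zZ) => G GM.
have: x \in D G by rewrite (subsetP (DF G GM)) // inE.
have [fG _ _] := spanning_forestsP _ _ _ (min_forests_spanning GM).
rewrite inE => xDG.
have [rG _] := root_ofP (forest_acyclic fG) x.
by rewrite (atom_root_of atomZ GM zZ xDG) (root_of_sink (forest_acyclic fG) rG).
Qed.

End Atoms.

(** * Outgoing restrictions and outgoing trees *)

Section OutgoingRestrictions.
Variables (N : finType) (E : {set N * N}).
Implicit Types (F G T : digraph N) (D Z : {set N}).

Lemma acyclic_sub G T : (forall x y, arc T x y -> arc G x y) ->
  acyclic G -> acyclic T.
Proof.
by move=> TG /acyclicP[h hG]; apply/acyclicP; exists h => x y /TG /hG.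
Qed.

Lemma out_degree_sub G T : (forall x y, arc T x y -> arc G x y) ->
  out_degree_le1 G -> out_degree_le1 T.
Proof.
move=> TG /out_degree_le1P dG; apply/out_degree_le1P => x y z /TG xy /TG.
exact: dG.
Qed.

Lemma star_tree T q : is_forest E T -> q \in vertices T ->
  (forall x, x \in vertices T -> connect (arc T) x q) -> is_tree E T.
Proof.
move=> fT qT cT; rewrite /is_tree fT; apply/cards1P; exists (vertices T).
apply/setP => C; rewrite inE; have comp x : x \in vertices T -> component T x = vertices T.
  move=> xT; apply/setP => y; rewrite inE andb_idr // => yT.
  apply: connect_trans (connect_adjacent (cT x xT)) _.
  by rewrite adjacent_sym connect_adjacent ?cT.
apply/imsetP/eqP => [[x xT ->]|->]; first exact: comp.
by exists q => //; rewrite comp.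
Qed.

Lemma arc_out_restr D G x y : arc (out_restr D G) x y = arc G x y && (x \in D).
Proof. by rewrite /arc inE. Qed.

Lemma NoutP D G y :
  reflect (y \notin D /\ exists2 x, x \in D & arc G x y) (y \in Nout D G).
Proof.
by rewrite inE; apply: (iffP andP) => [] [yD] => [/exists_inP|/exists_inP].
Qed.

Lemma weight_swap (R : realType) (v : N -> N -> R) D F G :
  weight v (swap D F G)
    = weight v (out_restr D F) + weight v (out_restr (~: D) G).
Proof.
rewrite !weightE -big_split; apply: eq_bigr => a _ /=.
rewrite !inE; case: (a.1 \in D); rewrite ?andbT ?andbF ?addr0 ?add0r //.
Qed.

Lemma out_restr_swap D F G : out_restr D (swap D F G) = out_restr D F.
Proof.
congr (_, _); last by apply/setP => a; rewrite !inE; case: (a.1 \in D); rewrite ?andbF.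
congr (_ :|: _); apply/setP => y; rewrite !inE; congr (_ && _).
by apply: eq_existsb => x; rewrite arc_swap; case: (x \in D).
Qed.

Lemma outgoing_treeP D T : T \in outgoing_trees E D ->
  [/\ is_forest E T, sinks T :&: D = set0 & exists2 q, q \notin D &
     vertices T = q |: D].
Proof.
rewrite inE => /and5P[/andP[fT _] /eqP cT DT _ /forallP rT].
split=> //.
  apply/setP => x; rewrite in_setI in_set0; apply/negP => /andP[/sinkP sx xD].
  have := rT x; rewrite xD implybF /is_root (subsetP DT) //= => /negP; apply.
  exact/forallP.
have /cards1P[q eqD] : #|vertices T :\: D| == 1%N.
  by rewrite cardsD (setIidPr DT) cT subSnn.
exists q; first by have := set11 q; rewrite -eqD inE => /andP[].
by rewrite -eqD setUC -{1}(setIidPr DT) setID.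
Qed.

(** The root reached from a vertex of [D] lies outside [D], so it is the extra vertex [q]. Hence
    every arc starts in [D], and [q] is the head of one of them. *)
Lemma out_restr_outgoing_tree D T : D != set0 -> T \in outgoing_trees E D ->
  out_restr D T = T.
Proof.
move=> /set0Pn[x xD] /outgoing_treeP[fT noT [q nqD vT]].
have /and3P[/andP[_ /forall_inP endT] dT aT] := fT.
have arcT a b : arc T a b -> (a \in q |: D) && (b \in q |: D).
  by move/endT; rewrite vT.
have qsink : q \in sinks T.
  have [rT cr] := root_ofP aT x.
  case/connectP: cr => p; elim/last_ind: p => [|p y _].
    by move=> _ /= eqx; move/setP/(_ x): noT; rewrite in_setI in_set0 -{1}eqx rT xD.
  rewrite rcons_path last_rcons => /andP[_ /arcT/andP[_]] + eqr; rewrite -eqr.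
  rewrite in_setU1 => /orP[/eqP <- //|rD].
  by move/setP/(_ (root_of T x)): noT; rewrite in_setI in_set0 rT rD.
have arcD a b : arc T a b -> a \in D.
  move=> ab; have /andP[+ _] := arcT _ _ ab; rewrite in_setU1 => /orP[/eqP eqa|//].
  by move/sinkP/(_ b): qsink; rewrite -eqa ab.
have [y yD yq] : exists2 y, y \in D & arc T y q.
  have: x \in D -> exists2 y, y \in D & arc T y q; last exact.
  elim/(root_ind aT): x {xD} => [r rT rD|a b ab IHb aD].
    by move/setP/(_ r): noT; rewrite in_setI in_set0 rT rD.
  have /andP[_] := arcT _ _ ab; rewrite in_setU1 => /orP[/eqP <-|//].
  by exists a.
rewrite /out_restr [RHS]surjective_pairing; congr (_, _); last first.
  by apply/setP => -[a b]; rewrite inE andb_idr //; apply: arcD.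
rewrite -[RHS]/(vertices T) vT setUC; congr (_ :|: _); apply/setP => b.
rewrite in_set1; apply/NoutP/eqP => [[nbD [a _ /arcT/andP[_]]]|->].
  by rewrite in_setU1 (negPf nbD) orbF => /eqP.
by split=> //; exists y.
Qed.

End OutgoingRestrictions.

(** * Minimal forests with [k - 1] trees around the labeled atom *)

Section LabeledAtomTree.
Variables (R : realType) (N : finType) (E : {set N * N}) (v : N -> N -> R).
Implicit Types (F G T : digraph N) (D Z : {set N}).

Local Notation weight := (weight v).
Local Notation M := (min_forests E v).
Local Notation SF := (spanning_forests E).

Variable k : nat.
Hypothesis k_gt0 : (0 < k)%N.
Hypothesis gap : forall F G H, F \in M k -> G \in SF k.-1 -> H \in SF k.+1 ->
  weight F + weight F < weight G + weight H.
Variable Z : {set N}.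
Hypothesis Z_labeled : Z \in labeled_atoms E v k.
Hypothesis Z_out : forall F, F \in M k.-1 -> Nout Z F != set0.
Variable F0 : digraph N.
Hypothesis F0M : F0 \in M k.
Hypothesis F0Z : forall x, (root_of F0 x \in Z) = (x \in Z).

Let F0_spanning : F0 \in SF k.
Proof. exact: min_forests_spanning F0M. Qed.

Let F0_forest : is_forest E F0.
Proof. by case/spanning_forestsP: F0_spanning. Qed.

Let F0_acyclic : acyclic F0 := forest_acyclic F0_forest.

Lemma arc_F0 x y : arc F0 x y -> (x \in Z) = (y \in Z).
Proof.
move=> xy; rewrite -F0Z -(F0Z y).
by rewrite (root_of_arc F0_acyclic (forest_out_degree F0_forest) xy).
Qed.

Lemma labeled_atom_tree : exists2 r, r \in sinks F0 & tree F0 r = Z.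
Proof.
have atomZ := labeled_atom_atom Z_labeled.
have /set0Pn[z zZ] : Z != set0 by move: atomZ; rewrite inE => /and3P[].
have [rF _] := root_ofP F0_acyclic z; exists (root_of F0 z) => //.
apply/setP => x; rewrite in_tree; apply/eqP/idP => [eqx|xZ].
  by rewrite -F0Z eqx F0Z.
exact: atom_root_of atomZ F0M xZ zZ.
Qed.

(** Pigeonhole: [F0] has [k - 1] trees besides [Z], and the roots of [G] outside [Z] are fewer. *)
Lemma rootless_tree G : (#|sinks G :\: Z| < k.-1)%N ->
  exists r, [/\ r \in sinks F0, r \notin Z & sinks G :&: tree F0 r = set0].
Proof.
move=> ltG; have [r0 r0F eqZ] := labeled_atom_tree.
have /subsetPn[r] : ~~ (sinks F0 :\ r0 \subset root_of F0 @: (sinks G :\: Z)).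
  apply/negP => /subset_leq_card; apply/negP; rewrite -ltnNge.
  apply: leq_ltn_trans (leq_imset_card _ _) (leq_trans ltG _).
  have [_ _ <-] := spanning_forestsP _ _ _ F0_spanning.
  by rewrite (cardsD1 r0) r0F.
rewrite in_setD1 => /andP[neq rF] nim.
have rZ : r \notin Z by rewrite -eqZ in_tree (root_of_sink F0_acyclic rF).
exists r; split=> //; apply/setP => s; rewrite in_set0 in_setI in_tree.
apply/negP => /andP[sG /eqP eqr]; case/imsetP: nim; exists s => //.
by rewrite in_setD sG andbT -F0Z eqr.
Qed.

Lemma Nout_swap_tree G r : r \notin Z -> Nout Z (swap (tree F0 r) G F0) = set0.
Proof.
move=> rZ; apply/setP => y; rewrite in_set0; apply/NoutP => -[nyZ [x xZ]].
rewrite arc_swap in_tree; case: eqP => [eqx|_ /arc_F0].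
  by rewrite -eqx F0Z xZ in rZ.
by rewrite xZ (negPf nyZ).
Qed.

(** A root in [Z] would leave at most [k - 2] roots elsewhere, hence a rootless tree of [F0];
    swapping it yields a minimal forest without exit from [Z], against [Z_out]. *)
Lemma next_sinks G : G \in M k.-1 -> sinks G :&: Z = set0.
Proof.
move=> GM; have Gk := min_forests_spanning GM.
have [_ _ cG] := spanning_forestsP _ _ _ Gk.
apply/eqP; rewrite -cards_eq0 -leqn0 leqNgt; apply/negP => ltG.
have leG : (#|sinks G :&: Z| <= #|sinks G|)%N by rewrite subset_leq_card ?subsetIl.
have [|r [rF rZ noG]] := @rootless_tree G; first by rewrite -cG cardsD; lia.
have /= := swap_tree rF F0_spanning Gk; rewrite noG cards0 add0n subn0 add1n.
have k1 : (0 < k.-1)%N by rewrite -cG (leq_trans ltG).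
rewrite prednK // => -[HF HG].
have /Z_out : swap (tree F0 r) G F0 \in M k.-1.
  by apply: min_forests_sum GM F0M HF HG _; rewrite weight_swapD.
by rewrite Nout_swap_tree ?eqxx.
Qed.

Lemma swap_next G : G \in M k.-1 -> swap Z G F0 \in M k.-1.
Proof.
move=> GM; have [r rF eqZ] := labeled_atom_tree.
have /= := swap_tree rF F0_spanning (min_forests_spanning GM).
rewrite eqZ next_sinks // cards0 add0n subn0 add1n prednK // => -[HF HG].
by apply: min_forests_sum GM F0M HF HG _; rewrite weight_swapD.
Qed.

(** [G] has only [k - 2] roots, so a rootless tree other than [Z] exists. Both swaps then have
    [k - 1] trees, and if the inequality failed they would be minimal, one of them without exit from
    [Z]. *)
Lemma second_gap A G : (1 < k)%N -> A \in M k.-1 -> G \in M k.-2 ->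
  weight A + weight A < weight G + weight F0.
Proof.
move=> k_gt1 AM GM; rewrite ltNge; apply/negP => le.
have Gk := min_forests_spanning GM.
have [_ _ cG] := spanning_forestsP _ _ _ Gk.
have [|r [rF rZ noG]] := @rootless_tree G.
  by apply: leq_ltn_trans (subset_leq_card (subsetDl _ _)) _; rewrite cG; lia.
have /= := swap_tree rF F0_spanning Gk; rewrite noG cards0 add0n subn0 add1n.
rewrite prednK; last by lia.
case=> HF HG; have /Z_out : swap (tree F0 r) G F0 \in M k.-1.
  by apply: (min_forests_sum AM AM HF HG); rewrite weight_swapD.
by rewrite Nout_swap_tree ?eqxx.
Qed.

(* Let z be the vertex where the path of G from the root r of F0 leaves Z, Z1 the
   vertices of Z going through z, and W the rest of Z.  Swapping F0 into W and
   into Z1 gives forests with k-1 and k trees of total weight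
   phi^(k-1) + phi^k, so the latter is minimal; its trees meeting W have their
   roots outside Z, hence W is empty. *)
Lemma unique_exit G : G \in M k.-1 ->
  exists z q, [/\ z \in Z, q \notin Z, arc G z q &
    forall x, x \in Z -> connect (arc (swap Z G F0)) x z].
Proof.
move=> GM; set G1 := swap Z G F0.
have G1M : G1 \in M k.-1 := swap_next GM.
have [fG1 _ cG1] := spanning_forestsP _ _ _ (min_forests_spanning G1M).
have aG1 := forest_acyclic fG1; have dG1 := forest_out_degree fG1.
have noG1 := next_sinks G1M.
have G1out x y : arc G1 x y -> x \notin Z -> y \notin Z.
  by rewrite arc_swap => + /negPf nxZ; rewrite nxZ => /arc_F0 <-; rewrite nxZ.
have exit x : x \in Z -> exists z q,
    [/\ z \in Z, q \notin Z, arc G1 z q & connect (arc G1) x z].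
  elim/(root_ind aG1): x => [r rG1 rZ|a b ab IHb aZ].
    by move/setP/(_ r): noG1; rewrite in_setI in_set0 rG1 rZ.
  have [/IHb[z [q [zZ nqZ zq bz]]]|nbZ] := boolP (b \in Z).
    by exists z, q; split=> //; apply: connect_trans (connect1 ab) bz.
  by exists a, b; split.
have [r rF eqZ] := labeled_atom_tree.
have rZ : r \in Z by rewrite -eqZ in_tree (root_of_sink F0_acyclic rF).
have [z [q [zZ nqZ zq rz]]] := exit r rZ.
exists z, q; split=> //; first by move: zq; rewrite arc_swap zZ.
pose Z1 := [set x | connect (arc G1) x z]; pose W := Z :\: Z1.
have Z1out x y : arc G1 x y -> x \notin Z1 -> y \notin Z1.
  move=> xy; rewrite !in_set; apply: contra; apply: connect_trans.
  exact: connect1.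
have Z1Z x : x \in Z1 -> x \in Z.
  apply: contraLR => nxZ; rewrite in_set; apply/negP => /connectP[p pp eqz].
  elim: p x nxZ pp eqz => [x nxZ _ eqz|y p IHp x nxZ /= /andP[xy py]].
    by rewrite /= in eqz; rewrite -eqz zZ in nxZ.
  exact: IHp (G1out _ _ xy nxZ) py.
have Wout x y : arc G1 x y -> x \notin W -> y \notin W.
  move=> xy; rewrite !in_setD !negb_and !negbK => /orP[xZ1|nxZ]; last first.
    by rewrite (G1out _ _ xy nxZ) orbT.
  have [//|nyZ] := boolP (y \in Z1).
  (* With a single arc out of [x], a nonempty path from [x] to [z] would pass through [y]. So [x] is
     [z], and [y] is then [q], which lies outside [Z]. *)
  have eqxz : x = z.
    move: xZ1 nyZ; rewrite !in_set => /connectP[[|y' p] //= /andP[xy' pp] eqz].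
    rewrite (out_degree_le1P _ dG1 _ _ _ xy xy') => /negP[].
    by apply/connectP; exists p.
  by rewrite (out_degree_le1P _ dG1 _ _ _ xy (_ : arc G1 x q)) ?eqxz.
have cK := spanning_swap F0_spanning (min_forests_spanning G1M) Wout.
have cH := spanning_swap F0_spanning (min_forests_spanning G1M) Z1out.
have sF0 : sinks F0 :&: Z = [set r] by rewrite -eqZ sinks_tree.
have sW : (#|sinks F0 :&: W| + #|sinks G1 :\: W| = k.-1)%N.
  have -> : sinks F0 :&: W = set0.
    apply/setP => x; rewrite in_setI in_setD in_set0; apply/negP => /and3P[xF nxZ1 xZ].
    have: x \in [set r] by rewrite -sF0 in_setI xF xZ.
    by rewrite in_set1 => /eqP eqx; rewrite eqx in_set rz in nxZ1.
  rewrite cards0 add0n -cG1; apply: eq_card => x; rewrite in_setD andb_idl // => xG1.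
  have: x \notin sinks G1 :&: Z by rewrite noG1 in_set0.
  by rewrite in_setI xG1 /= => /negPf nxZ; rewrite in_setD nxZ andbF.
have sZ1 : (#|sinks F0 :&: Z1| + #|sinks G1 :\: Z1| = k)%N.
  have -> : sinks F0 :&: Z1 = [set r].
    apply/setP => x; rewrite -sF0 !in_setI; case xF : (x \in sinks F0) => //=.
    apply/idP/idP => [/Z1Z //|xZ].
    have: x \in [set r] by rewrite -sF0 in_setI xF xZ.
    by rewrite in_set1 => /eqP ->; rewrite in_set.
  have -> : sinks G1 :\: Z1 = sinks G1.
    apply/setP => x; rewrite in_setD andb_idl // => xG1.
    apply/negP => /Z1Z xZ.
    have: x \in sinks G1 :&: Z by rewrite in_setI xG1.
    by rewrite noG1 in_set0.
  by rewrite cards1 cG1 add1n prednK.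
rewrite sW in cK; rewrite sZ1 in cH.
have HM : swap Z1 F0 G1 \in M k.
  (* The totals agree arc by arc: each part of [Z] takes [F0] in exactly one of the swaps, and off
     [Z] the forest [G1] coincides with [F0]. *)
  apply: min_forests_sum F0M G1M cH cK _; rewrite !weightE -!big_split /=.
  apply: ler_sum => a _; rewrite !in_arcs_swap in_setD.
  have [_|_] := boolP (a.1 \in Z1); first exact: lexx.
  have [_|_] := boolP (a.1 \in Z); first by rewrite addrC lexx.
  exact: lexx.
move=> x xZ; apply: contraT => nxZ1.
have := labeled_atom_root k_gt0 gap Z_labeled HM xZ.
have [fH _ _] := spanning_forestsP _ _ _ cH.
(* Outside [Z1] the swap follows [G1], which never enters [Z1] and has no root in [Z]. *)
have nroot y : y \notin Z1 -> root_of (swap Z1 F0 G1) y \notin Z.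
  elim/(root_ind (forest_acyclic fH)): y => [s sH nsZ1|a b ab IHb naZ1].
    rewrite (root_of_sink (forest_acyclic fH) sH).
    move: sH; rewrite sinks_swap in_setU in_setI in_setD (negPf nsZ1) andbF /= => sG1.
    have: s \notin sinks G1 :&: Z by rewrite noG1 in_set0.
    by rewrite in_setI sG1.
  rewrite (root_of_arc (forest_acyclic fH) (forest_out_degree fH) ab).
  by apply: IHb; move: ab; rewrite arc_swap (negPf naZ1) => /Z1out; apply.
by rewrite (negPf (nroot x _)) // in_set.
Qed.

(** By [unique_exit], [z -> q] is the only arc of [G] leaving [Z]: the restriction is a tree rooted
    at [q], and its part induced on [Z] is a tree rooted at [z]. *)
Lemma out_restr_next G : G \in M k.-1 -> out_restr Z G \in outgoing_trees E Z.
Proof.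
move=> GM; have [z [q [zZ nqZ zq cz]]] := unique_exit GM.
have [fG _ _] := spanning_forestsP _ _ _ (min_forests_spanning GM).
have /and3P[/andP[/subsetP GE _] dG aG] := fG.
set G1 := swap Z G F0 in cz.
have [fG1 _ _] := spanning_forestsP _ _ _ (min_forests_spanning (swap_next GM)).
have G1Z x y : x \in Z -> arc G x y -> arc G1 x y by rewrite arc_swap => ->.
(* If [x] differs from [z], its path to [z] begins with the arc to [y] outside [Z], and [G1] never
   returns to [Z]. *)
have exit x y : x \in Z -> y \notin Z -> arc G x y -> x = z /\ y = q.
  move=> xZ nyZ xy; suff eqx : x = z.
    by split=> //; rewrite eqx in xy; apply: (out_degree_le1P _ dG) xy zq.
  case/connectP: (cz x xZ) => -[//|y' p] /= /andP[xy' py'] eqz.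
  move: xy'; rewrite arc_swap xZ => /(out_degree_le1P _ dG _ _ _ xy) eqy.
  rewrite -eqy in py' eqz; suff: z \notin Z by rewrite zZ.
  have nout a b : arc G1 a b -> a \notin Z -> b \notin Z.
    by rewrite arc_swap => + /negPf naZ; rewrite naZ => /arc_F0 <-; rewrite naZ.
  rewrite eqz; elim: p y nyZ py' {xy eqz eqy} => //= b p IHp a naZ /andP[ab pb].
  exact: IHp (nout _ _ ab naZ) pb.
have NoutG : Nout Z G = [set q].
  apply/setP => y; rewrite in_set1; apply/NoutP/eqP => [[nyZ [x xZ xy]]|->].
    by have [] := exit x y xZ nyZ xy.
  by split=> //; exists z.
pose T := out_restr Z G.
have TG x y : arc T x y -> arc G x y by rewrite arc_out_restr => /andP[].
have IG x y : arc (induced Z T) x y = [&& arc G x y, x \in Z & y \in Z].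
  by rewrite /arc !inE /=; case: (x \in Z); rewrite ?andbF ?andbT.
have subI x y : arc (induced Z T) x y -> arc G x y by rewrite IG => /and3P[].
have vT : vertices T = q |: Z by rewrite /T /out_restr NoutG setUC.
have fT : is_forest E T.
  apply/and3P; split; [|exact: out_degree_sub TG dG|exact: acyclic_sub TG aG].
  apply/andP; split; first by apply/subsetP => a; rewrite inE => /andP[/GE].
  apply/forall_inP => -[x y] /[!inE] /andP[xy /= xZ]; rewrite xZ /=.
  by case: (y \in Z) => //=; apply/exists_inP; exists x.
have vI : vertices (induced Z T) = Z.
  by rewrite -[LHS]/(vertices T :&: Z) vT; apply/setIidPr/subsetUr.
have fI : is_forest E (induced Z T).
  apply/and3P; split; [|exact: out_degree_sub subI dG|exact: acyclic_sub subI aG].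
  apply/andP; split.
    by apply/subsetP => a /[!inE] /andP[/andP[/GE]].
  by apply/forall_inP => -[x y]; rewrite vI !inE /= => /and3P[_ -> ->].
have cI x : x \in Z -> connect (arc (induced Z T)) x z.
  elim/(root_ind (forest_acyclic fG1)): x => [r rG1 rZ|a b ab IHb aZ].
    by rewrite (connect_sink rG1 (cz r rZ)) connect0.
  move: ab; rewrite arc_swap aZ => ab.
  have [bZ|nbZ] := boolP (b \in Z); last by have [-> _] := exit a b aZ nbZ ab.
  by apply: connect_trans (connect1 _) (IHb bZ); rewrite IG ab aZ.
rewrite inE; apply/and5P; split.
- apply: (star_tree fT (q := q)) => [|x]; first by rewrite vT setU11.
  rewrite vT in_setU1 => /orP[/eqP -> //|xZ].
  apply: connect_trans (connect1 (_ : arc T z q)); last by rewrite arc_out_restr zq.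
  apply: connect_sub (cI x xZ) => a b; rewrite IG => /and3P[ab aZ _].
  by apply: connect1; rewrite arc_out_restr ab.
- by rewrite vT cardsU1 nqZ.
- by rewrite vT subsetUr.
- rewrite inE vI eqxx andbT; apply: (star_tree fI (q := z)); first by rewrite vI.
  by move=> x; rewrite vI; apply: cI.
apply/forallP => x; apply/implyP => /andP[_ /forallP rx]; apply/negP => xZ.
have: x \notin sinks G :&: Z by rewrite next_sinks // in_set0.
rewrite in_setI xZ andbT => /not_sink[y xy].
by have := rx y; rewrite arc_out_restr xy xZ.
Qed.

Lemma swap_outgoing_tree T : T \in outgoing_trees E Z -> swap Z T F0 \in SF k.-1.
Proof.
case/outgoing_treeP => fT noT _; apply/spanning_forestsP; split=> //.
  by apply: forest_swap => // x y /arc_F0 ->.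
have [r rF eqZ] := labeled_atom_tree.
have [_ _ cF] := spanning_forestsP _ _ _ F0_spanning.
by rewrite card_sinks_swap noT cards0 cardsD -eqZ sinks_tree // cards1 cF subn1.
Qed.

Lemma min_outgoing_treesP T :
  reflect (T \in outgoing_trees E Z /\
             forall T', T' \in outgoing_trees E Z -> weight T <= weight T')
          (T \in min_outgoing_trees E v Z).
Proof. exact: bigmin_attainedP. Qed.

(** The weight of [swap Z T F0] is that of [T] plus a constant from [F0] outside [Z], so minimising
    over trees [T] matches minimising over such forests. *)
Lemma out_restr_min_forests : (exists G, G \in M k.-1) ->
  [set out_restr Z F | F in M k.-1] = min_outgoing_trees E v Z.
Proof.
have Z0 : Z != set0.
  by move: (labeled_atom_atom Z_labeled); rewrite inE => /and3P[].
case=> G GM; apply/setP => T; apply/imsetP/min_outgoing_treesP.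
  case=> {GM}G GM ->; split; first exact: out_restr_next.
  move=> T' outT'; have [_ minG] := min_forestsP _ _ _ _ (swap_next GM).
  have := minG _ (swap_outgoing_tree outT').
  by rewrite !weight_swap lerD2r (out_restr_outgoing_tree Z0 outT').
case=> outT minT; exists (swap Z T F0); last first.
  by rewrite out_restr_swap (out_restr_outgoing_tree Z0 outT).
have [_ minG] := min_forestsP _ _ _ _ (swap_next GM).
apply/min_forestsP; split; first exact: swap_outgoing_tree.
move=> H /minG; apply: le_trans; rewrite !weight_swap lerD2r.
by rewrite (out_restr_outgoing_tree Z0 outT) minT // out_restr_next.
Qed.

End LabeledAtomTree.

Theorem theorem5 (R : realType) (N : finType) (E : {set N * N})
    (v : N -> N -> R)
    (loopless : forall i : N, (i, i) \notin E)
    (has_spanning_tree : spanning_forests E 1 != set0)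
    (k : nat) (k_ge2 : (2 <= k)%N) (k_le : (k <= #|N| - 1)%N)
    (gap_k : (phi E v (k - 1) - phi E v k > phi E v k - phi E v (k + 1))%E)
    (Z : {set N}) (Z_labeled : Z \in labeled_atoms E v k)
    (Z_out : forall F : digraph N,
        F \in min_forests E v (k - 1) -> Nout Z F != set0) :
  [set out_restr Z F | F in min_forests E v (k - 1)]
    = min_outgoing_trees E v Z
  /\ (phi E v (k - 2) - phi E v (k - 1) > phi E v (k - 1) - phi E v k)%E
  /\ (phi E v (k - 1) - phi E v k > phi E v k - phi E v (k + 1))%E.
Proof.
have minex j : (0 < j <= #|N|)%N -> exists F, F \in min_forests E v j.
  case/(spanning_forests_exist has_spanning_tree) => F.
  exact: min_forests_exist.
move: (gap_k) Z_out; rewrite subn1 addn1 subn2 => gap_k' Z_out.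
have k_gt0 : (0 < k)%N by lia.
have [A AM] : exists F, F \in min_forests E v k.-1 by apply: minex; lia.
have [B BM] : exists F, F \in min_forests E v k.+1 by apply: minex; lia.
(* The bounds on [k] make all three values of [phi] finite, so the extended-real gap becomes a real
   inequality. *)
have gap F G H : F \in min_forests E v k -> G \in spanning_forests E k.-1 ->
    H \in spanning_forests E k.+1 ->
    weight v F + weight v F < weight v G + weight v H.
  move=> FM Gk Hk; move: gap_k'.
  rewrite (phiE FM) (phiE AM) (phiE BM) -!EFinB lte_fin.
  have [_ /(_ _ Gk)] := min_forestsP _ _ _ _ AM.
  have [_ /(_ _ Hk)] := min_forestsP _ _ _ _ BM.
  lra.
have [F0 F0M F0Z] := tree_of_labeled_atom k_gt0 gap Z_labeled.
split; first by apply: (out_restr_min_forests k_gt0 gap Z_labeled Z_out F0M F0Z); exists A.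
split=> //; rewrite (phiE AM) (phiE F0M).
(* With no forest on [k - 2] trees, as when [k = 2], [phi] is [+oo] there and the inequality is
   immediate. *)
have [noF|[G Gk]] := set_0Vmem (spanning_forests E k.-2).
  by rewrite /phi noF big_set0 /= ltry.
have [C CM] := min_forests_exist v Gk.
rewrite (phiE CM) -!EFinB lte_fin.
have := second_gap k_gt0 Z_labeled Z_out F0M F0Z k_ge2 AM CM; lra.
Qed.
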